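(* Let $ABC$ be a nondegenerate triangle with $a=|BC|$, $b=|CA|$, $c=|AB|$, circumcenter $O$ and circumradius $R$, let $x,y,z$ be real numbers with $x+y+z\neq0$, and let $P=(x+y+z)^{-1}[x,y,z]$. Then $$R^2(x+y+z)^2-\left(yza^2+zxb^2+xyc^2\right)=(x+y+z)^2|PO|^2\ \ge\ 0 .$$
   Context: Barycentric coordinates are taken with respect to triangle $ABC$ and normalized: $[u,v,w]$ with $u+v+w=1$ denotes the point $uA+vB+wC$ (affine combination of the vertices). *)

(* Defs.v *)
From mathcomp Require Import all_boot all_order all_algebra.
From mathcomp Require Import reals.
Set Implicit Arguments. Unset Strict Implicit. Unset Printing Implicit Defensive.
Import Order.TTheory GRing.Theory Num.Theory.
Local Open Scope ring_scope.

(* Points of the Euclidean plane are row vectors in 'rV[K]_2, with K the field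
   of real numbers. *)

(* The Euclidean distance; the norm that MathComp-Analysis puts on matrices
   is the sup norm. *)
Definition dist (K : realType) (P Q : 'rV[K]_2) : K :=
  Num.sqrt (\sum_(i < 2) (P 0 i - Q 0 i) ^+ 2).

(* The vertices are affinely independent: B - A and C - A are linearly
   independent. *)
Definition nondegenerate_triangle (K : realType) (A B C : 'rV[K]_2) : bool :=
  row_free (col_mx (B - A) (C - A)).

Definition is_circumcircle (K : realType) (A B C O : 'rV[K]_2) (R : K) : Prop :=
  [/\ dist O A = R, dist O B = R & dist O C = R].

(* The point [u, v, w], meaningful when u + v + w = 1. *)
Definition bary (K : realType) (A B C : 'rV[K]_2) (u v w : K) : 'rV[K]_2 :=
  u *: A + v *: B + w *: C.

(* Main.v *)
Require Import Defs.
From mathcomp Require Import all_boot all_order all_algebra.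
From mathcomp Require Import reals.
From mathcomp Require Import ring.
Set Implicit Arguments. Unset Strict Implicit. Unset Printing Implicit Defensive.
Import Order.TTheory GRing.Theory Num.Theory.
Local Open Scope ring_scope.

(** The identity is Leibniz's formula for the squared distance from a weighted
    barycenter to a point, applied at the circumcenter, where the three distances
    to the vertices all equal the circumradius. Leibniz's formula itself holds
    coordinate by coordinate. *)

Lemma sqr_dist (K : realType) (P Q : 'rV[K]_2) :
  dist P Q ^+ 2 = \sum_(i < 2) (P 0 i - Q 0 i) ^+ 2.
Proof. by rewrite sqr_sqrtr // sumr_ge0 // => i _; rewrite sqr_ge0. Qed.

(** In one coordinate, [s] times the barycenter minus [q] is x(a-q) + y(b-q) + z(c-q). Its square
    has cross terms 2yz(b-q)(c-q) = yz((b-q)^2 + (c-q)^2 - (b-c)^2), and cyclically. *)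
Lemma leibniz_dist (K : realType) (A B C Q : 'rV[K]_2) (x y z : K) :
  let s := x + y + z in
  s != 0 ->
  s ^+ 2 * dist (bary A B C (s^-1 * x) (s^-1 * y) (s^-1 * z)) Q ^+ 2 =
  s * (x * dist Q A ^+ 2 + y * dist Q B ^+ 2 + z * dist Q C ^+ 2)
  - (y * z * dist B C ^+ 2 + z * x * dist C A ^+ 2 + x * y * dist A B ^+ 2).
Proof.
(* Each side becomes one sum over the two coordinates, so summands can be compared. *)
move=> s s_neq0; rewrite !sqr_dist !mulr_sumr -!big_split mulr_sumr -sumrB /=.
apply: eq_bigr => i _; rewrite /bary !mxE -exprMn /s.
by field.
Qed.

Theorem mainTheorem9 (K : realType) (A B C O P : 'rV[K]_2) (a b c R x y z : K)
  (hABC : nondegenerate_triangle A B C)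
  (ha : a = dist B C) (hb : b = dist C A) (hc : c = dist A B)
  (hO : is_circumcircle A B C O R)
  (hxyz : x + y + z != 0)
  (hP : P = bary A B C ((x + y + z)^-1 * x) ((x + y + z)^-1 * y)
                       ((x + y + z)^-1 * z)) :
  R ^+ 2 * (x + y + z) ^+ 2
    - (y * z * a ^+ 2 + z * x * b ^+ 2 + x * y * c ^+ 2)
    = (x + y + z) ^+ 2 * dist P O ^+ 2
  /\ (x + y + z) ^+ 2 * dist P O ^+ 2 >= 0.
Proof.
split; last by rewrite mulr_ge0 ?sqr_ge0.
have [OA OB OC] := hO.
(* At [O] the weighted sum of squared distances collapses to [(x + y + z) * R ^+ 2]. *)
by rewrite hP leibniz_dist // OA OB OC ha hb hc; ring.
Qed.
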